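(* Let $\Upsilon_2$ be the free monoid of rank $2$ and let $\mathrm{Rep}_2(2)_B:=\mathrm{Rep}_2(\Upsilon_2)_B$ be the representation variety of degree $2$ with Borel mold for $\Upsilon_2$. The universal sub-line bundle $\mathcal{L}_2:=\mathcal{L}_{\Upsilon_2}$ on $\mathrm{Rep}_2(2)_B$ is not trivial, i.e. it is not isomorphic to $\mathcal{O}_{\mathrm{Rep}_2(2)_B}$.
   Context: Let $X$ be a scheme. A representation of degree $n$ for a group (resp. monoid) $\Gamma$ on $X$ is a group homomorphism $\rho:\Gamma\to \mathrm{GL}_n(\Gamma(X,\mathcal{O}_X))$ (resp. a monoid homomorphism $\rho:\Gamma\to \mathrm{M}_n(\Gamma(X,\mathcal{O}_X))$). A mold of degree $n$ on $X$ is a subsheaf of $\mathcal{O}_X$-algebras (containing the identity matrix) $\mathcal{A}\subseteq \mathrm{M}_n(\mathcal{O}_X)$ such that $\mathcal{A}$ and $\mathrm{M}_n(\mathcal{O}_X)/\mathcal{A}$ are locally free sheaves. Two molds $\mathcal{A},\mathcal{B}$ of degree $n$ on $X$ are locally equivalent if every $x\in X$ has an open neighborhood $U$ and some $P_U\in \mathrm{GL}_n(\mathcal{O}_U)$ with $P_U^{-1}(\mathcal{A}|_U)P_U=\mathcal{B}|_U$. Let $\mathcal{B}_n\subset \mathrm{M}_n(\mathbb{Z})$ be the subalgebra of upper triangular matrices. A Borel mold of degree $n$ on $X$ is a mold locally equivalent to $\mathcal{B}_n\otimes_{\mathbb{Z}}\mathcal{O}_X$. A representation with Borel mold on $X$ is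 a representation $\rho$ of degree $n$ on $X$ such that the subsheaf of $\mathcal{O}_X$-algebras $\mathcal{O}_X[\rho(\Gamma)]\subseteq \mathrm{M}_n(\mathcal{O}_X)$ generated by $\rho(\Gamma)$ is a Borel mold. $\mathrm{Rep}_n(\Gamma)_B$ is the scheme over $\mathbb{Z}$ representing the contravariant functor sending a scheme $X$ to the set of degree $n$ representations with Borel mold for $\Gamma$ on $X$; it is a subscheme of the affine scheme $\mathrm{Rep}_n(\Gamma)$ representing all degree $n$ representations of $\Gamma$. The universal representation makes $\Gamma$ act on the trivial bundle $\mathcal{O}^{\oplus n}_{\mathrm{Rep}_n(\Gamma)_B}$ (via $\mathrm{M}_n(\Gamma(X,\mathcal{O}_X))=\mathrm{End}_{\mathcal{O}_X}(\mathcal{O}_X^{\oplus n})$ with $X=\mathrm{Rep}_n(\Gamma)_B$). A subbundle of $\mathcal{O}_X^{\oplus n}$ is a locally free subsheaf with locally free quotient. For $n=2$ there is a unique $\Gamma$-invariant rank $1$ subbundle $\mathcal{L}_\Gamma\subset \mathcal{O}_{\mathrm{Rep}_2(\Gamma)_B}^{\oplus 2}$, called the universal sub-line bundle on $\mathrm{Rep}_2(\Gamma)_B$. *)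

(* Defs.v *)
From HB Require Import structures.
From mathcomp Require Import all_boot all_order all_algebra.
From mathcomp Require Import boolp classical_sets topology_structure.

Set Implicit Arguments.
Unset Strict Implicit.
Unset Printing Implicit Defensive.

Import GRing.Theory.
Local Open Scope classical_set_scope.
Local Open Scope ring_scope.

Record opens (T : topologicalType) := Opens {
  carrier :> set T;
  open_carrier : open carrier }.

Definition in_open (T : topologicalType) (U : opens T) (x : T) : Prop :=
  carrier U x.
Coercion in_open : opens >-> Funclass.

Definition top_open (T : topologicalType) : opens T := Opens (@openT T).

Lemma sub_top (T : topologicalType) (U : opens T) : U `<=` top_open T.
Proof. by []. Qed.

(* The compatibility of the family [s] is required on every open [W] contained
   in both [V i] and [V j], which amounts to requiring it on the intersection. *)
Definition is_sheaf (T : topologicalType) (F : opens T -> Type)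
    (r : forall U V : opens T, V `<=` U -> F U -> F V) : Prop :=
  forall (U : opens T) (I : Type) (V : I -> opens T)
         (hV : forall i, V i `<=` U),
    U `<=` \bigcup_i V i ->
    forall s : forall i, F (V i),
      (forall i j (W : opens T) (hi : W `<=` V i) (hj : W `<=` V j),
          r _ _ hi (s i) = r _ _ hj (s j)) ->
      exists! t : F U, forall i, r _ _ (hV i) t = s i.

(* [comPzRingType] allows the zero ring, the sections over the empty open set. *)
Record ringed_space := RingedSpace {
  space :> topologicalType;
  OX : opens space -> comPzRingType;
  res : forall U V : opens space, V `<=` U -> {rmorphism OX U -> OX V};
  res_id : forall (U : opens space) (h : U `<=` U) s, res h s = s;
  res_comp : forall (U V W : opens space) (hUV : V `<=` U) (hVW : W `<=` V)
    (hUW : W `<=` U) s, res hVW (res hUV s) = res hUW s;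
  OX_sheaf : is_sheaf (F := OX) (fun U V h => res h) }.

(* For [x] in [U]: the germ of [s] at [x] is a unit of the stalk at [x]. *)
Definition unit_at (X : ringed_space) (x : X) (U : opens X) (s : OX U) : Prop :=
  exists (V : opens X) (h : V `<=` U), V x /\ exists t, res h s * t = 1.

(* All stalks are local rings: [1 <> 0] in the stalk at [x], and if the sum of
   two germs at [x] is a unit, then one of them is. *)
Definition locally_ringed (X : ringed_space) : Prop :=
  forall (x : X) (U : opens X), U x ->
    (1 : OX U) <> 0 /\
    forall s t : OX U, unit_at x (s + t) -> unit_at x s \/ unit_at x t.

Definition prime_ideal (R : comPzRingType) (p : set R) : Prop :=
  [/\ p 0,
      forall a b, p a -> p b -> p (a + b),
      forall a b, p b -> p (a * b),
      ~ p 1 &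
      forall a b, p (a * b) -> p a \/ p b].

(* [g] exhibits [S] as the localization of [R] at the powers of [f]. *)
Definition is_localization (R S : comPzRingType) (f : R)
    (g : {rmorphism R -> S}) : Prop :=
  [/\ exists u, g f * u = 1,
      forall s : S, exists a n, g f ^+ n * s = g a &
      forall a, g a = 0 -> exists n, f ^+ n * a = 0].

(* [psi] (on [U]) and [phi] identify the ringed space [U], with the restriction
   of the structure sheaf of [X], with Spec R: [psi] is a bijection from [U] to
   the set of prime ideals of [R], under which the open sets are the unions of
   sets D(f), and [phi] identifies the sections over D(f) with the localization
   R_f.  As the D(f) form a basis, this determines the structure sheaf. *)
Definition is_Spec (X : ringed_space) (U : opens X) (R : comPzRingType)
    (psi : X -> set R) (phi : {rmorphism R -> OX U}) : Prop :=
  [/\ forall x, U x -> prime_ideal (psi x),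
      forall x y, U x -> U y -> psi x = psi y -> x = y,
      forall p, prime_ideal p -> exists2 x, U x & psi x = p,
      forall W : set X, W `<=` U ->
        (open W <->
         forall x, W x -> exists2 f, ~ psi x f &
           forall y, U y -> ~ psi y f -> W y) &
      forall (f : R) (D : opens X) (h : D `<=` U),
        (forall x, D x <-> U x /\ ~ psi x f) ->
        is_localization f [the {rmorphism R -> OX D} of res h \o phi]].

Definition affine (X : ringed_space) (U : opens X) : Prop :=
  exists (R : comPzRingType) (psi : X -> set R) (phi : {rmorphism R -> OX U}),
    is_Spec psi phi.

Record scheme := Scheme {
  rspace :> ringed_space;
  scheme_locally_ringed : locally_ringed rspace;
  scheme_locally_affine : forall x : rspace, exists2 U : opens rspace,
    U x & affine U }.

Definition preim (Y X : topologicalType) (f : Y -> X) (cf : continuous f)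
  (U : opens X) : opens Y :=
  Opens ((continuousP f).1 cf _ (open_carrier U)).

Lemma preim_sub (Y X : topologicalType) (f : Y -> X) (cf : continuous f)
  (U V : opens X) : V `<=` U -> preim cf V `<=` preim cf U.
Proof. by move=> h y; apply: h. Qed.

Record morphism (Y X : ringed_space) := Morphism {
  mor_map :> Y -> X;
  mor_cont : continuous mor_map;
  comap : forall U : opens X, {rmorphism OX U -> OX (preim mor_cont U)};
  comap_res : forall (U V : opens X) (h : V `<=` U) (s : OX U),
    comap V (res h s) = res (preim_sub h) (comap U s);
  comap_local : forall (y : Y) (U : opens X) (s : OX U),
    U (mor_map y) -> unit_at y (comap U s) -> unit_at (mor_map y) s }.
Arguments mor_cont {Y X} _.

Record sheaf_mod (X : ringed_space) := SheafMod {
  msec : forall U : opens X, lmodType (OX U);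
  mres : forall U V : opens X, V `<=` U -> msec U -> msec V;
  mres_linear : forall (U V : opens X) (h : V `<=` U) a s t,
    mres h (a *: s + t) = res h a *: mres h s + mres h t;
  mres_id : forall (U : opens X) (h : U `<=` U) s, mres h s = s;
  mres_comp : forall (U V W : opens X) (hUV : V `<=` U) (hVW : W `<=` V)
    (hUW : W `<=` U) s, mres hVW (mres hUV s) = mres hUW s;
  msec_sheaf : is_sheaf (F := msec) mres }.

Record mod_hom (X : ringed_space) (M N : sheaf_mod X) := ModHom {
  hom_fun :> forall U : opens X, {linear msec M U -> msec N U};
  hom_nat : forall (U V : opens X) (h : V `<=` U) s,
    hom_fun V (mres h s) = mres h (hom_fun U s) }.

Definition isomorphic (X : ringed_space) (M N : sheaf_mod X) : Prop :=
  exists f : mod_hom M N, forall U, bijective (f U).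

(* The restrictions of [M] and [N] to the open subspace [U] are isomorphic. *)
Definition isomorphic_on (X : ringed_space) (U : opens X) (M N : sheaf_mod X) :
    Prop :=
  exists f : forall V : opens X, V `<=` U -> {linear msec M V -> msec N V},
    (forall (V : opens X) (h : V `<=` U), bijective (f V h)) /\
    (forall (V W : opens X) (hV : V `<=` U) (hW : W `<=` U) (h : W `<=` V) s,
       f W hW (mres h s) = mres h (f V hV s)).

Section StructureSheaf.
Variable X : ringed_space.

Let osec (U : opens X) : lmodType (OX U) := (OX U)^o.
Let ores (U V : opens X) (h : V `<=` U) : osec U -> osec V := res h.

Fact ores_linear (U V : opens X) (h : V `<=` U) a (s t : osec U) :
  ores h (a *: s + t) = res h a *: ores h s + ores h t.
Proof. by rewrite /ores /= rmorphD rmorphM. Qed.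

Definition structure_sheaf : sheaf_mod X :=
  SheafMod ores_linear (@res_id X) (@res_comp X) (@OX_sheaf X).

End StructureSheaf.

Section MatrixSheaf.
Variables (X : ringed_space) (m n : nat).

Let xsec (U : opens X) : lmodType (OX U) := 'M[OX U]_(m, n).
Definition resmx (U V : opens X) (h : V `<=` U) : xsec U -> xsec V :=
  map_mx (res h).

Fact resmx_linear (U V : opens X) (h : V `<=` U) a (s t : xsec U) :
  resmx h (a *: s + t) = res h a *: resmx h s + resmx h t.
Proof. by rewrite /resmx /= map_mxD map_mxZ. Qed.

Fact resmx_id (U : opens X) (h : U `<=` U) (s : xsec U) : resmx h s = s.
Proof. by apply/matrixP => i j; rewrite mxE res_id. Qed.

Fact resmx_comp (U V W : opens X) (hUV : V `<=` U) (hVW : W `<=` V)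
  (hUW : W `<=` U) (s : xsec U) : resmx hVW (resmx hUV s) = resmx hUW s.
Proof. by apply/matrixP => i j; rewrite !mxE; apply: res_comp. Qed.

Fact resmx_sheaf : is_sheaf (F := xsec) resmx.
Proof.
move=> U I V hV cov s cs.
have glue (ij : 'I_m * 'I_n) :
    exists! t : OX U, forall k, res (hV k) t = s k ij.1 ij.2.
  apply: (OX_sheaf hV cov (s := fun k => s k ij.1 ij.2)) => k l W hk hl.
  by have /matrixP/(_ ij.1 ij.2) := cs k l W hk hl; rewrite !mxE.
have [t tP] := choice glue.
exists (\matrix_(i, j) t (i, j)); split.
  by move=> k; apply/matrixP => i j; rewrite !mxE (tP (i, j)).1.
move=> u uP; apply/matrixP => i j; rewrite mxE; apply: (tP (i, j)).2 => k.
by rewrite -(uP k) mxE.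
Qed.

Definition mxsheaf : sheaf_mod X :=
  SheafMod resmx_linear resmx_id resmx_comp resmx_sheaf.

End MatrixSheaf.

(* The free module O_X^r; its sections are column vectors. *)
Notation free_sheaf X r := (mxsheaf X r 1).

Definition locally_free_rank (X : ringed_space) (r : nat) (M : sheaf_mod X) :
    Prop :=
  forall x : X, exists2 U : opens X, U x & isomorphic_on U M (free_sheaf X r).

Definition locally_free (X : ringed_space) (M : sheaf_mod X) : Prop :=
  forall x : X, exists2 U : opens X, U x &
    exists r, isomorphic_on U M (free_sheaf X r).

Record submod (X : ringed_space) (M : sheaf_mod X) := Submod {
  ssec :> forall U : opens X, set (msec M U);
  ssec0 : forall U : opens X, ssec (0 : msec M U);
  ssec_linear : forall (U : opens X) a (s t : msec M U),
    ssec s -> ssec t -> ssec (a *: s + t);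
  ssec_res : forall (U V : opens X) (h : V `<=` U) (s : msec M U),
    ssec s -> ssec (mres h s);
  ssec_local : forall (U : opens X) (s : msec M U),
    (forall x, U x -> exists (V : opens X) (h : V `<=` U),
       V x /\ ssec (mres h s)) ->
    ssec s }.
Arguments ssec {X M} _ U _.

Section SubSheaf.
Variables (X : ringed_space) (M : sheaf_mod X) (L : submod M).

Definition sub_pred (U : opens X) : {pred msec M U} := fun s => `[< L U s >].

Fact sub_pred_closed (U : opens X) : submod_closed (@sub_pred U).
Proof.
split; first exact/asboolP/ssec0.
by move=> a s t /asboolP sL /asboolP tL; apply/asboolP/ssec_linear.
Qed.

HB.instance Definition _ (U : opens X) :=
  GRing.isSubmodClosed.Build (OX U) (msec M U) (@sub_pred U)
    (@sub_pred_closed U).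

Definition sub_sec (U : opens X) := {s : msec M U | sub_pred s}.

HB.instance Definition _ (U : opens X) := SubChoice.on (sub_sec U).
HB.instance Definition _ (U : opens X) :=
  [SubChoice_isSubLmodule of sub_sec U by <:].

Fact sub_res_subproof (U V : opens X) (h : V `<=` U) (s : sub_sec U) :
  sub_pred (mres h (val s)).
Proof. by apply/asboolP/ssec_res/asboolP/(valP s). Qed.

Definition sub_res (U V : opens X) (h : V `<=` U) (s : sub_sec U) : sub_sec V :=
  Sub (mres h (val s)) (sub_res_subproof h s).

Fact sub_res_linear (U V : opens X) (h : V `<=` U) a (s t : sub_sec U) :
  sub_res h (a *: s + t) = res h a *: sub_res h s + sub_res h t.
Proof.
by apply: val_inj; rewrite /= mres_linear.
Qed.

Fact sub_res_id (U : opens X) (h : U `<=` U) (s : sub_sec U) : sub_res h s = s.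
Proof. by apply: val_inj; rewrite /= mres_id. Qed.

Fact sub_res_comp (U V W : opens X) (hUV : V `<=` U) (hVW : W `<=` V)
  (hUW : W `<=` U) (s : sub_sec U) : sub_res hVW (sub_res hUV s) = sub_res hUW s.
Proof. by apply: val_inj; rewrite /=; apply: mres_comp. Qed.

Fact sub_res_sheaf : is_sheaf sub_res.
Proof.
move=> U I V hV cov s cs.
have [t [tP tu]] := msec_sheaf hV cov (s := fun i => val (s i))
  (fun i j W hi hj => congr1 val (cs i j W hi hj)).
have tL : sub_pred t.
  apply/asboolP/ssec_local => x /cov[i _ Vix].
  by exists (V i), (hV i); split; rewrite // tP; apply/asboolP/(valP (s i)).
exists (Sub t tL); split=> [i|u uP]; apply: val_inj; rewrite /= ?tP //.
by apply: tu => i; rewrite -uP.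
Qed.

Definition subsheaf : sheaf_mod X :=
  @SheafMod X (fun U => sub_sec U) sub_res sub_res_linear sub_res_id
    sub_res_comp sub_res_sheaf.

End SubSheaf.

(* [q] exhibits [Q] as the quotient sheaf [M / L]: [q] is an epimorphism of
   sheaves (sections of [Q] lift locally) with kernel [L]. *)
Definition is_quotient (X : ringed_space) (M : sheaf_mod X) (L : submod M)
    (Q : sheaf_mod X) (q : mod_hom M Q) : Prop :=
  (forall (U : opens X) (t : msec Q U) (x : X), U x ->
     exists (V : opens X) (h : V `<=` U) (s : msec M V),
       V x /\ q V s = mres h t) /\
  (forall (U : opens X) (s : msec M U), q U s = 0 <-> L U s).

Definition locally_free_quotient (X : ringed_space) (M : sheaf_mod X)
    (L : submod M) : Prop :=
  exists (Q : sheaf_mod X) (q : mod_hom M Q), is_quotient L q /\ locally_free Q.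

Definition subbundle (X : ringed_space) (n : nat) (L : submod (free_sheaf X n)) :
    Prop :=
  locally_free (subsheaf L) /\ locally_free_quotient L.

Definition is_subalgebra (X : ringed_space) (n : nat)
    (A : submod (mxsheaf X n n)) : Prop :=
  forall U : opens X, A U 1%:M /\
    forall P Q : 'M[OX U]_n, A U P -> A U Q -> A U (P *m Q).

Definition mold (X : ringed_space) (n : nat) (A : submod (mxsheaf X n n)) :
    Prop :=
  [/\ is_subalgebra A, locally_free (subsheaf A) & locally_free_quotient A].

(* [Q] plays the role of the inverse of [P], an element of GL_n(O(U)). *)
Definition locally_equivalent (X : ringed_space) (n : nat)
    (A B : submod (mxsheaf X n n)) : Prop :=
  forall x : X, exists2 U : opens X, U x &
    exists P Q : 'M[OX U]_n,
      [/\ P *m Q = 1%:M, Q *m P = 1%:M &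
          forall (V : opens X) (h : V `<=` U),
            [set resmx h Q *m M *m resmx h P | M in A V] = B V].

(* The subsheaf of upper triangular matrices of M_n(O_X): since the upper
   triangular matrices over Z are spanned by part of the standard basis of
   M_n(Z), this is their tensor product with O_X. *)
Section UpperTriangular.
Variables (X : ringed_space) (n : nat).

Let utsec (U : opens X) : set (msec (mxsheaf X n n) U) :=
  [set M : 'M[OX U]_n | forall i j : 'I_n, (j < i)%N -> M i j = 0].

Fact ut0 (U : opens X) : @utsec U 0.
Proof. by move=> i j _; rewrite mxE. Qed.

Fact ut_linear (U : opens X) a s t :
  @utsec U s -> @utsec U t -> @utsec U (a *: s + t).
Proof. by move=> hs ht i j ij; rewrite !mxE hs // ht // mulr0 addr0. Qed.

Fact ut_res (U V : opens X) (h : V `<=` U) s : @utsec U s -> utsec (mres h s).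
Proof. by move=> hs i j ij; rewrite mxE hs // rmorph0. Qed.

Fact ut_local (U : opens X) s :
  (forall x, U x -> exists (V : opens X) (h : V `<=` U),
     V x /\ utsec (mres h s)) -> @utsec U s.
Proof.
move=> hs i j ij.
pose I := {V : opens X | exists h : V `<=` U, res h ((s : 'M_n) i j) = 0}.
have hV (v : I) : sval v `<=` U by case: v => V /= [h _]; apply: h.
have cov : U `<=` \bigcup_(v : I) sval v.
  move=> x Ux; have [V [h [Vx sV]]] := hs x Ux.
  have := sV i j ij; rewrite mxE => {}sV.
  by exists (exist _ V (ex_intro _ h sV)).
have compat0 (v w : I) (W : opens X) (hv : W `<=` sval v) (hw : W `<=` sval w) :
  res hv 0 = res hw 0 by rewrite !rmorph0.
have [t [_ tu]] := OX_sheaf hV cov compat0.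
rewrite -(tu 0); last by move=> v; rewrite rmorph0.
apply/esym/tu => v; have [h hr] := svalP v.
by rewrite (Prop_irrelevance (hV v) h).
Qed.

Definition upper_triangular : submod (mxsheaf X n n) :=
  Submod ut0 ut_linear ut_res ut_local.

End UpperTriangular.

Definition borel_mold (X : ringed_space) (n : nat)
    (A : submod (mxsheaf X n n)) : Prop :=
  mold A /\ locally_equivalent A (upper_triangular X n).

Record representation (G : monoidType) (n : nat) (X : ringed_space) :=
  Representation {
    rho :> G -> 'M[OX (top_open X)]_n;
    rho1 : rho 1%g = 1%:M;
    rhoM : forall g h : G, rho (g * h)%g = rho g *m rho h }.

(* The subsheaf of algebras generated by the image of a representation, as the
   intersection of all the subsheaves of algebras containing it. *)
Section Generated.
Variables (G : monoidType) (n : nat) (X : ringed_space).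
Variable r : representation G n X.

Let gsec (U : opens X) : set (msec (mxsheaf X n n) U) :=
  [set M | forall A : submod (mxsheaf X n n), is_subalgebra A ->
     (forall g, A (top_open X) (r g)) -> A U M].

Fact gen0 (U : opens X) : @gsec U 0.
Proof. by move=> A _ _; apply: ssec0. Qed.

Fact gen_linear (U : opens X) a s t :
  @gsec U s -> @gsec U t -> @gsec U (a *: s + t).
Proof. by move=> hs ht A Aa Ag; apply: ssec_linear; [apply: hs|apply: ht]. Qed.

Fact gen_res (U V : opens X) (h : V `<=` U) s : @gsec U s -> gsec (mres h s).
Proof. by move=> hs A Aa Ag; apply/ssec_res/hs. Qed.

Fact gen_local (U : opens X) s :
  (forall x, U x -> exists (V : opens X) (h : V `<=` U),
     V x /\ gsec (mres h s)) -> @gsec U s.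
Proof.
move=> hs A Aa Ag; apply: ssec_local => x /hs[V [h [Vx hV]]].
by exists V, h; split=> //; apply: hV.
Qed.

Definition generated_algebra : submod (mxsheaf X n n) :=
  Submod gen0 gen_linear gen_res gen_local.

End Generated.

Definition with_borel_mold (G : monoidType) (n : nat) (X : ringed_space)
    (r : representation G n X) : Prop :=
  borel_mold (generated_algebra r).

(* [X], with the universal representation [r], represents the contravariant
   functor sending a scheme [Y] to the set of representations of degree [n]
   with Borel mold for [G] on [Y]; that is, [X] is Rep_n(G)_B. *)
Definition is_RepB (G : monoidType) (n : nat) (X : scheme)
    (r : representation G n X) : Prop :=
  with_borel_mold r /\
  forall (Y : scheme) (s : representation G n Y), with_borel_mold s ->
    exists! f : morphism Y X, forall g : G,
      s g = resmx (@sub_top Y (top_open Y) : top_open Y `<=`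
                     preim (mor_cont f) (top_open X))
              (map_mx (comap f (top_open X)) (r g)).

Definition invariant (G : monoidType) (n : nat) (X : ringed_space)
    (r : representation G n X) (L : submod (free_sheaf X n)) : Prop :=
  forall (g : G) (U : opens X) (s : 'cV[OX U]_n),
    L U s -> L U (resmx (@sub_top X U) (r g) *m s).

(* A representation with Borel mold has exactly one such [L]; that of the
   universal representation is the universal sub-line bundle. *)
Definition invariant_line_subbundle (G : monoidType) (X : scheme)
    (r : representation G 2 X) (L : submod (free_sheaf X 2)) : Prop :=
  [/\ subbundle L, locally_free_rank 1 (subsheaf L) & invariant r L].

(* Words in [k] letters, under concatenation. *)
Definition free_monoid (k : nat) := seq 'I_k.

HB.instance Definition _ (k : nat) := Choice.on (free_monoid k).
HB.instance Definition _ (k : nat) :=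
  isMonoid.Build (free_monoid k) (@catA 'I_k) (@cat0s 'I_k) (@cats0 'I_k).

(* Main.v *)
(* Were the universal line bundle trivial, a global generator of it would pull
   back, along the classifying morphism of any representation with Borel mold on
   a scheme Y, to a unimodular pair (a, b) of global functions on Y spanning an
   invariant line.  Take Y = Spec Z[w] with w^2 = -5, and
     N = [1 + w, -2; w - 2, -1 - w],  A = N D = [w - 1, -1 - w; -3, 2 - w],
   where D = [1, -1; 1, 0].  N is nilpotent; its kernel, the pairs (x, y) with
   (1 + w) x = 2 y, is isomorphic by the first projection to the nonprincipal
   ideal (2, 1 + w).  A is idempotent with image ker N, and 1, A, N, D form a
   basis of M_2(Z[w]).  The algebra generated by A and N is spanned by 1, A, N,
   i.e. it is the kernel of M |-> tr(N M), the Borel subalgebra stabilizing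
   ker N: N generates Hom(Z[w]^2 / ker N, ker N) because the square of the ideal
   (2, 1 + w) is principal.
   The eigenvalue of the nilpotent N on (a, b) is 0, so (1 + w) a = 2 b, and the
   norm form x^2 + 5 y^2 excludes this for a unimodular pair. *)
Require Import Defs.
From HB Require Import structures.
From mathcomp Require Import all_boot all_order all_algebra.
From mathcomp Require Import algC.
From mathcomp Require Import boolp classical_sets functions topology_structure.
From mathcomp Require Import ring zify.

Set Implicit Arguments.
Unset Strict Implicit.
Unset Printing Implicit Defensive.

Import GRing.Theory Num.Theory.
Local Open Scope classical_set_scope.
Local Open Scope ring_scope.

(** * The spectrum of a subring of a field *)

Definition ideal (R : comPzRingType) (I : set R) : Prop :=
  [/\ I 0, forall a b, I a -> I b -> I (a + b) & forall a b, I b -> I (a * b)].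

(** By Zorn's lemma there is an ideal above [I] maximal among those missing all powers of [f], and
    it is prime: if [a] and [b] lie outside it, adjoining either one captures a power of [f], and
    the product of the two powers lies in [p + (a b)]. *)
Lemma prime_avoiding (R : comPzRingType) (I : set R) (f : R) :
  ideal I -> (forall n, ~ I (f ^+ n)) ->
  exists p, [/\ prime_ideal p, I `<=` p & ~ p f].
Proof.
move=> [I0 ID IM] If.
(* The empty set is admitted so as to be the union of the empty chain. *)
pose good A := A = set0 \/
  [/\ ideal A, I `<=` A & forall n, ~ A (f ^+ n)].
have chain (F : set (set R)) : F `<=` good -> total_on F subset ->
    good (\bigcup_(A in F) A).
  move=> Fg Ft; have [/existsNP [A /not_implyP[FA A0]]|F0] :=
    pselect (~ forall A, F A -> A = set0); last first.
    left; apply/seteqP; split=> // x [A FA Ax].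
    by move/contrapT/(_ A FA): F0 Ax => ->.
  right; have ne B x : F B -> B x ->
      [/\ ideal B, I `<=` B & forall n, ~ B (f ^+ n)].
    by move=> /Fg[->|].
  have [[A00 AD AM] IA Af] : [/\ ideal A, I `<=` A & forall n, ~ A (f ^+ n)].
    by case: (Fg A FA).
  split; first split.
  - by exists A.
  - move=> a b [B FB Ba] [C FC Cb].
    have [BC|CB] := Ft B C FB FC.
      exists C => //; have [[_ CD _] _ _] := ne C b FC Cb.
      by apply: CD => //; apply: BC.
    exists B => //; have [[_ BD _] _ _] := ne B a FB Ba.
    by apply: BD => //; apply: CB.
  - move=> a b [B FB Bb]; exists B => //.
    by have [[_ _ BM] _ _] := ne B b FB Bb; apply: BM.
  - by move=> x Ix; exists A => //; apply: IA.
  - by move=> n [B FB Bf]; have [_ _ /(_ n)] := ne B _ FB Bf.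
(* The maximal set is not empty, since [I] would be strictly larger. *)
have [p [[p0|[[p0 pD pM] Ip pf]] pmax]] := Zorn_bigcup chain.
  case: (pmax I); last by right; split.
  by rewrite p0; split=> // /(_ 0 I0).
have grow a : ~ p a -> exists n u v, p u /\ f ^+ n = u + v * a.
  move=> pa; apply: contrapT => no.
  pose q := [set x | exists u v, p u /\ x = u + v * a].
  have pq : p `<` q.
    split=> [x px|qp]; first by exists x, 0; rewrite mul0r addr0.
    by apply/pa/qp; exists 0, 1; rewrite add0r mul1r.
  apply: (pmax q pq).
  right; split; first split.
  - by exists 0, 0; rewrite mul0r addr0.
  - move=> x y [u [v [pu ->]]] [u' [v' [pu' ->]]].
    by exists (u + u'), (v + v'); split; [apply: pD|ring].
  - move=> x y [u [v [pu ->]]]; exists (x * u), (x * v).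
    by split; [apply: pM|ring].
  - by move=> x /Ip px; exists x, 0; rewrite mul0r addr0.
  - by move=> n [u [v uv]]; apply: no; exists n, u, v.
exists p; split=> //; last by move=> pf1; apply: (pf 1%N); rewrite expr1.
split=> //; first by move=> p1; apply: (pf 0%N); rewrite expr0.
move=> a b pab; apply: contrapT => /not_orP[/grow[n [u [v [pu fn]]]]].
move=> /grow[m [u' [v' [pu' fm]]]]; apply: (pf (n + m)%N).
rewrite exprD fn fm.
have -> : (u + v * a) * (u' + v' * b) =
  (u' + v' * b) * u + (v * a * u' + v * v' * (a * b)) by ring.
by apply/pD; [apply: pM|apply: pD; apply: pM].
Qed.

(** The combinations of [a] and [b] form an ideal; if it misses 1, [prime_avoiding] with [f = 1]
    puts it inside a prime. *)
Lemma coprime_unit (R : comPzRingType) (a b : R) :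
  (forall p, prime_ideal p -> p a -> p b -> False) ->
  exists u v, u * a + v * b = 1.
Proof.
move=> no; apply: contrapT => no1.
have [||p [pp Ip _]] := @prime_avoiding R
  [set x | exists u v, x = u * a + v * b] 1.
- split; first by exists 0, 0; ring.
    by move=> x y [u [v ->]] [u' [v' ->]]; exists (u + u'), (v + v'); ring.
  by move=> x y [u [v ->]]; exists (x * u), (x * v); ring.
- by move=> n; rewrite expr1n => -[u [v uv]]; apply: no1; exists u, v.
apply: (no p pp); apply: Ip; first by exists 1, 0; ring.
by exists 0, 1; ring.
Qed.

(** * Points and Zariski topology of Spec R *)

Definition spec (R : comPzRingType) := {p : set R | prime_ideal p}.

HB.instance Definition _ (R : comPzRingType) := gen_eqMixin (spec R).
HB.instance Definition _ (R : comPzRingType) := gen_choiceMixin (spec R).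

Lemma prime_mul (R : comPzRingType) (x : spec R) (a b : R) :
  ~ sval x (a * b) <-> ~ sval x a /\ ~ sval x b.
Proof.
have [_ _ pM _ pP] := svalP x; split=> [xab|[xa xb]]; last by move/pP => [].
by split=> xa; apply: xab; [rewrite mulrC|]; apply: pM.
Qed.

Section Zariski.
Variable R : comPzRingType.

Definition zariski_open (W : set (spec R)) : Prop :=
  forall x, W x -> exists2 f, ~ sval x f & forall y : spec R, ~ sval y f -> W y.

Fact zariski_openT : zariski_open setT.
Proof. by move=> x _; exists 1 => //; have [] := svalP x. Qed.

Fact zariski_openI : setI_closed zariski_open.
Proof.
move=> V W oV oW x [/oV[f xf fV] /oW[g xg gW]]; exists (f * g).
  exact/prime_mul.
by move=> y /prime_mul[yf yg]; split; [apply: fV|apply: gW].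
Qed.

Fact zariski_open_bigU (I : Type) (f : I -> set (spec R)) :
  (forall i, zariski_open (f i)) -> zariski_open (\bigcup_i f i).
Proof.
move=> fo x [i _ /(fo i)[g xg gf]]; exists g => // y yg.
by exists i => //; apply: gf.
Qed.

HB.instance Definition _ := isOpenTopological.Build (spec R)
  zariski_openT zariski_openI zariski_open_bigU.

Lemma spec_openE (W : set (spec R)) : open W <-> zariski_open W.
Proof. by []. Qed.

End Zariski.

(** * The structure sheaf of Spec R for a subring R of a field K *)

Section SpecSheaf.
Variables (R : comPzRingType) (K : fieldType) (i : {rmorphism R -> K}).

(* Near [x], namely on D(b), the section [s] is the fraction a/b. *)
Definition fraction_at (U : opens (spec R)) (s : {y | U y} -> K) (x : spec R)
    (a b : R) : Prop :=
  [/\ ~ sval x b, i b != 0 &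
    forall y : {y | U y}, ~ sval (sval y) b -> s y = i a / i b].

(** For injective [i] all local rings of [R] embed in [K], so a section can take its values in one
    field instead of in varying stalks. *)
Definition spec_pred (U : opens (spec R)) : {pred {y | U y} -> K} :=
  fun s => `[< forall x, U x -> exists a b, fraction_at s x a b >].

Fact spec_pred_closed (U : opens (spec R)) : subring_closed (@spec_pred U).
Proof.
split.
- apply/asboolP => x _; exists 1, 1; have [_ _ _ ? _] := svalP x.
  by split=> //; rewrite ?rmorph1 ?oner_neq0 // => y _; rewrite divr1.
- move=> s t /asboolP hs /asboolP ht; apply/asboolP => x Ux.
  have [a [b [xb b0 sE]]] := hs x Ux; have [c [d [xd d0 tE]]] := ht x Ux.
  exists (a * d - c * b), (b * d); split.
  + exact/prime_mul.
  + by rewrite rmorphM mulf_neq0.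
  + move=> y /prime_mul[yb yd]; rewrite !fctE sE // tE // rmorphB !rmorphM.
    by field; rewrite b0 d0.
- move=> s t /asboolP hs /asboolP ht; apply/asboolP => x Ux.
  have [a [b [xb b0 sE]]] := hs x Ux; have [c [d [xd d0 tE]]] := ht x Ux.
  exists (a * c), (b * d); split.
  + exact/prime_mul.
  + by rewrite rmorphM mulf_neq0.
  + move=> y /prime_mul[yb yd]; rewrite !fctE sE // tE // !rmorphM.
    by field; rewrite b0 d0.
Qed.

HB.instance Definition _ (U : opens (spec R)) :=
  GRing.isSubringClosed.Build ({y | U y} -> K) (@spec_pred U)
    (@spec_pred_closed U).

Definition spec_sec (U : opens (spec R)) :=
  {s : {y | U y} -> K | spec_pred s}.

HB.instance Definition _ (U : opens (spec R)) := SubChoice.on (spec_sec U).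
HB.instance Definition _ (U : opens (spec R)) :=
  GRing.SubChoice_isSubComPzRing.Build _ _ (spec_sec U) (@spec_pred_closed U).

Definition spec_incl (U V : opens (spec R)) (h : V `<=` U) (y : {y | V y}) :
  {y | U y} := exist _ (sval y) (h _ (svalP y)).

Fact spec_res_subproof (U V : opens (spec R)) (h : V `<=` U) (s : spec_sec U) :
  @spec_pred V (val s \o spec_incl h).
Proof.
apply/asboolP => x Vx; have /asboolP/(_ x (h x Vx)) := valP s.
by move=> [a [b [xb b0 sE]]]; exists a, b; split=> // y yb; apply: sE.
Qed.

Definition spec_res (U V : opens (spec R)) (h : V `<=` U) (s : spec_sec U) :
  spec_sec V := Sub (val s \o spec_incl h) (spec_res_subproof h s).

Fact spec_res_zmod (U V : opens (spec R)) (h : V `<=` U) :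
  zmod_morphism (spec_res h).
Proof. by move=> s t; apply: val_inj. Qed.

Fact spec_res_monoid (U V : opens (spec R)) (h : V `<=` U) :
  monoid_morphism (spec_res h).
Proof. by split=> [|s t]; apply: val_inj. Qed.

HB.instance Definition _ (U V : opens (spec R)) (h : V `<=` U) :=
  GRing.isZmodMorphism.Build (spec_sec U) (spec_sec V) (spec_res h)
    (spec_res_zmod h).
HB.instance Definition _ (U V : opens (spec R)) (h : V `<=` U) :=
  GRing.isMonoidMorphism.Build (spec_sec U) (spec_sec V) (spec_res h)
    (spec_res_monoid h).

Lemma spec_sec_eq (U : opens (spec R)) (s t : spec_sec U) :
  (forall x (Ux : U x), val s (exist _ x Ux) = val t (exist _ x Ux)) -> s = t.
Proof. by move=> st; apply/val_inj/funext => -[x Ux]; apply: st. Qed.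

Lemma spec_sec_irr (U : opens (spec R)) (s : spec_sec U) x (h h' : U x) :
  val s (exist _ x h) = val s (exist _ x h').
Proof. by rewrite (Prop_irrelevance h h'). Qed.

Fact spec_res_id (U : opens (spec R)) (h : U `<=` U) s : spec_res h s = s.
Proof. by apply: spec_sec_eq => x Ux; apply: (spec_sec_irr s). Qed.

Fact spec_res_comp (U V W : opens (spec R)) (hUV : V `<=` U) (hVW : W `<=` V)
  (hUW : W `<=` U) s : spec_res hVW (spec_res hUV s) = spec_res hUW s.
Proof. by apply: spec_sec_eq => x Wx; apply: (spec_sec_irr s). Qed.

Hypothesis i_inj : injective i.

Lemma i_neq0 (x : spec R) (b : R) : ~ sval x b -> i b != 0.
Proof.
have [x0 _ _ _ _] := svalP x; move=> xb; apply: contra_notN xb => /eqP ib.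
by rewrite (_ : b = 0) //; apply: i_inj; rewrite ib rmorph0.
Qed.

(** This is the generic point, which lies in every nonempty open set. *)
Lemma zero_prime : prime_ideal [set a : R | a = 0].
Proof.
split=> //.
- by move=> a b -> ->; rewrite addr0.
- by move=> a b ->; rewrite mulr0.
- by move=> /(congr1 i)/eqP; rewrite rmorph1 rmorph0 oner_eq0.
- move=> a b /(congr1 i)/eqP; rewrite rmorphM rmorph0 mulf_eq0.
  by case/orP => /eqP ab; [left|right]; apply: i_inj; rewrite rmorph0.
Qed.

Fact spec_sheaf : is_sheaf (F := spec_sec) spec_res.
Proof.
move=> U I V hV cov s cs.
have agree k l x (hk : V k x) (hl : V l x) :
    val (s k) (exist _ x hk) = val (s l) (exist _ x hl).
  pose W := Opens (openI (open_carrier (V k)) (open_carrier (V l))).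
  have Wk : W `<=` V k by move=> y [].
  have Wl : W `<=` V l by move=> y [].
  have /(congr1 (fun u : spec_sec W => val u (exist _ x (conj hk hl)))) :=
    cs k l W Wk Wl.
  rewrite /= (spec_sec_irr (s k) _ hk) (spec_sec_irr (s l) _ hl).
  exact.
have pick (y : {y | U y}) : exists k, V k (sval y).
  by case: y => y Uy /=; have [k _ Vk] := cov y Uy; exists k.
have [c cP] := choice pick.
pose t y := val (s (c y)) (exist _ (sval y) (cP y)).
have tE k x (Vx : V k x) (Ux : U x) :
    t (exist _ x Ux) = val (s k) (exist _ x Vx).
  exact: agree.
have tP : @spec_pred U t.
  apply/asboolP => x Ux; have [k _ Vkx] := cov x Ux.
  have /asboolP/(_ x Vkx)[a [b [xb b0 sE]]] := valP (s k).
  have [g xg gV] := (spec_openE _).1 (open_carrier (V k)) x Vkx.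
  have g0 := i_neq0 xg.
  (* The extra factor [g] confines the neighbourhood of [x] to [V k], where [t] agrees with
     [s k]. *)
  exists (a * g), (b * g); split.
  - exact/prime_mul.
  - by rewrite rmorphM mulf_neq0.
  - move=> [y Uy] /prime_mul[yb yg].
    rewrite (tE k y (gV y yg)) sE // !rmorphM.
    by field; rewrite b0 g0.
exists (Sub t tP); split=> [k|u uP].
  by apply: spec_sec_eq => x Vx; apply: tE.
apply: spec_sec_eq => x Ux; have [k _ Vx] := cov x Ux.
apply: etrans (tE k x Vx Ux) _; rewrite -(uP k) /= /spec_incl /=.
exact: spec_sec_irr.
Qed.

Definition spec_ringed_space : ringed_space :=
  @RingedSpace (spec R) (fun U => spec_sec U)
    (fun U V h => [the {rmorphism spec_sec U -> spec_sec V} of spec_res h])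
    spec_res_id spec_res_comp spec_sheaf.

Fact spec_const_subproof (U : opens (spec R)) (a : R) :
  @spec_pred U (fun=> i a).
Proof.
apply/asboolP => x _; exists a, 1; have [_ _ _ ? _] := svalP x.
by split=> //; rewrite ?rmorph1 ?oner_neq0 // => y _; rewrite divr1.
Qed.

Definition spec_const (U : opens (spec R)) (a : R) : spec_sec U :=
  Sub (fun=> i a) (spec_const_subproof U a).

Fact spec_const_zmod (U : opens (spec R)) : zmod_morphism (@spec_const U).
Proof. by move=> a b; apply: spec_sec_eq => x Ux; apply: rmorphB. Qed.

Fact spec_const_monoid (U : opens (spec R)) : monoid_morphism (@spec_const U).
Proof.
by split=> [|a b]; apply: spec_sec_eq => x Ux; [apply: rmorph1|apply: rmorphM].
Qed.

HB.instance Definition _ (U : opens (spec R)) :=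
  GRing.isZmodMorphism.Build R (spec_sec U) (@spec_const U) (spec_const_zmod U).
HB.instance Definition _ (U : opens (spec R)) :=
  GRing.isMonoidMorphism.Build R (spec_sec U) (@spec_const U)
    (spec_const_monoid U).

Definition basic_open (f : R) : opens (spec R).
Proof.
apply: (@Opens _ [set y : spec R | ~ sval y f]).
by apply/spec_openE => x xf; exists f.
Defined.

Fact spec_recip_subproof (f : R) (U : opens (spec R)) :
  U `<=` basic_open f -> @spec_pred U (fun=> (i f)^-1).
Proof.
move=> Uf; apply/asboolP => x /Uf xf; exists 1, f; split=> //.
  exact: i_neq0 xf.
by move=> y _; rewrite rmorph1 div1r.
Qed.

Lemma spec_unit (f : R) (U : opens (spec R)) :
  U `<=` basic_open f -> exists t, spec_const U f * t = 1.
Proof.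
move=> Uf; exists (Sub _ (spec_recip_subproof Uf)).
apply: spec_sec_eq => x Ux; rewrite /= !fctE mulfV //.
exact: i_neq0 (Uf x Ux).
Qed.

(** If a/b has an inverse c/d near [x], injectivity of [i] gives [a * c = b * d], which lies outside
    the prime [x]. Conversely, b/a is a section over the part of [U] in D(a) and D(b). *)
Lemma spec_unit_atP (x : spec_ringed_space) (U : opens (spec R)) (Ux : U x)
    (s : spec_sec U) (a b : R) :
  fraction_at (val s) x a b ->
  unit_at (X := spec_ringed_space) x s <-> ~ sval x a.
Proof.
move=> [xb b0 sE]; split.
  move=> [V [h [Vx [t]]]].
  move=> /(congr1 (fun u : spec_sec V => val u (exist _ x Vx))).
  rewrite /= !fctE /= sE // => st.
  have /asboolP/(_ x Vx)[c [d [xd d0 tE]]] := valP (t : spec_sec V).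
  rewrite tE // in st; move=> xa.
  have e : a * c = b * d.
    apply: i_inj; rewrite !rmorphM.
    exact: divr1_eq (etrans (esym (mulf_div _ _ _ _)) st).
  have : ~ sval x (b * d) by apply/prime_mul.
  by have [_ _ pM _ _] := svalP x; apply; rewrite -e mulrC; apply: pM.
move=> xa.
pose V := Opens (openI (open_carrier U)
  (openI (open_carrier (basic_open a)) (open_carrier (basic_open b)))).
have h : V `<=` U by move=> y [].
have Va : V `<=` basic_open a by move=> y [_ []].
have Vb : V `<=` basic_open b by move=> y [_ []].
have [t tE] := spec_unit Va.
exists V, h; split; first by [].
exists (spec_const V b * t); apply: spec_sec_eq => y Vy.
move/(congr1 (fun u : spec_sec V => val u (exist _ y Vy))): tE.
rewrite /= !fctE /= sE; last exact: Vb.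
by rewrite mulrA divfK.
Qed.

Fact spec_locally_ringed : locally_ringed spec_ringed_space.
Proof.
move=> x U Ux; split.
  move=> e; have /eqP : 1 = 0 :> K :=
    congr1 (fun u : spec_sec U => val u (exist _ x Ux)) e.
  by rewrite oner_eq0.
move=> s t.
have /asboolP/(_ x Ux)[a [b sE]] := valP (s : spec_sec U).
have /asboolP/(_ x Ux)[c [d tE]] := valP (t : spec_sec U).
rewrite (spec_unit_atP Ux sE) (spec_unit_atP Ux tE).
have [xb b0 {}sE] := sE; have [xd d0 {}tE] := tE.
have stE : fraction_at (val (s + t : spec_sec U)) x (a * d + c * b) (b * d).
  split; first exact/prime_mul.
    by rewrite rmorphM mulf_neq0.
  move=> y /prime_mul[yb yd]; rewrite /= !fctE sE // tE // rmorphD !rmorphM.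
  by field; rewrite b0 d0.
rewrite (spec_unit_atP Ux stE) => xn; apply: contrapT => /not_orP[].
move=> /contrapT xa /contrapT xc; apply: xn.
have [_ pD pM _ _] := svalP x.
by apply: pD; rewrite mulrC; apply: pM.
Qed.

(** The content is in the sections over D(f). Such a section is constant, as each of its local
    fractions is also valid at the generic point. The denominators of the constant form an ideal,
    which must contain a power of [f]. *)
Lemma spec_is_Spec :
  is_Spec (U := top_open spec_ringed_space) (fun x : spec R => sval x)
    [the {rmorphism R -> spec_sec (top_open (spec R))} of
       @spec_const (top_open (spec R))].
Proof.
split.
- by move=> x _; apply: svalP.
- by move=> [p pp] [q qq] _ _ /= e; apply/eq_exist.
- by move=> p pp; exists (exist _ p pp).
- move=> W _; split.
    move=> /spec_openE oW x /oW[f xf fW].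
    by exists f => // y _; apply: fW.
  move=> oW; apply/spec_openE => x /oW[f xf fW].
  by exists f => // y; apply: fW.
move=> f D h Df.
have DB : D `<=` basic_open f by move=> x /Df[].
pose eta : spec R := exist _ _ zero_prime.
have etaE a : sval eta a -> a = 0 by [].
have Deta : f <> 0 -> D eta by move=> f0; apply/Df; split=> // /etaE.
split.
- by have [u uf] := spec_unit DB; exists u; rewrite -uf; apply: val_inj.
- move=> s; have [f0|/Deta De] := pselect (f = 0).
    (* For [f = 0] the open set [D] is empty and any two sections over it agree. *)
    exists 0, 0%N; apply: spec_sec_eq => x Dx.
    by case: (DB x Dx); rewrite f0; have [] := svalP x.
  pose c := val (s : spec_sec D) (exist _ eta De).
  have sc x (Dx : D x) : exists a b,
      [/\ ~ sval x b, i b * c = i a & val s (exist _ x Dx) = c].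
    have /asboolP/(_ x Dx)[a [b [xb b0 sE]]] := valP (s : spec_sec D).
    exists a, b; rewrite /c !sE //; first by split=> //; rewrite mulrC divfK.
    by move=> /etaE b00; case: xb; rewrite b00; have [] := svalP x.
  have [n [a ca]] : exists n a, i (f ^+ n) * c = i a.
    apply: contrapT => no.
    (* Otherwise some prime avoiding [f] contains all denominators of [c]; it is a point of [D], yet
       [c] has a denominator outside it. *)
    have [||p [pp Ip pf]] := @prime_avoiding R
      [set b | exists a, i b * c = i a] f.
    - split; first by exists 0; rewrite !rmorph0 mul0r.
        move=> b b' [a ba] [a' ba']; exists (a + a').
        by rewrite !rmorphD mulrDl ba ba'.
      by move=> b b' [a ba]; exists (b * a); rewrite !rmorphM -mulrA ba.
    - by move=> n [a na]; apply: no; exists n, a.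
    have Dp : D (exist _ p pp) by apply/Df.
    have [a [b [pb bc _]]] := sc _ Dp.
    by apply: pb; apply: Ip; exists a.
  exists a, n; apply: spec_sec_eq => x Dx; rewrite -rmorphXn.
  have [_ [_ [_ _ sx]]] := sc x Dx.
  by rewrite /= !fctE /= sx.
- move=> a ga; have [f0|/Deta De] := pselect (f = 0).
    by exists 1%N; rewrite f0 expr1 mul0r.
  exists 0%N; rewrite expr0 mul1r; apply: i_inj; rewrite rmorph0.
  exact: (congr1 (fun u : spec_sec D => val u (exist _ eta De)) ga).
Qed.

Definition spec_scheme : scheme.
Proof.
apply: (@Scheme spec_ringed_space spec_locally_ringed) => x.
by exists (top_open _) => //; exists R, (fun x => sval x); eexists;
  apply: spec_is_Spec.
Defined.

End SpecSheaf.

(** * A representation with Borel mold from a square root of -5 *)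

Lemma ord2P (k : 'I_2) : {k = 0} + {k = 1}.
Proof. by case: k => -[|[|k]] ? //; [left|right]; apply: val_inj. Qed.

Section TwoByTwo.
Variable A : comPzRingType.
Implicit Types (a b c d w : A) (M : 'M[A]_2).

Definition mx2 a b c d : 'M[A]_2 :=
  \matrix_(i, j) if i == 0 then if j == 0 then a else b
                 else if j == 0 then c else d.

Lemma mx2_eta M : M = mx2 (M 0 0) (M 0 1) (M 1 0) (M 1 1).
Proof.
apply/matrixP => i j; rewrite !mxE.
by case: (ord2P i) => ->; case: (ord2P j) => ->.
Qed.

Lemma mx2M a b c d a' b' c' d' :
  mx2 a b c d *m mx2 a' b' c' d' =
  mx2 (a * a' + b * c') (a * b' + b * d') (c * a' + d * c') (c * b' + d * d').
Proof.
apply/matrixP => i j; rewrite !mxE !big_ord_recl big_ord0 addr0 !mxE /=.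
by case: (i == 0); case: (j == 0).
Qed.

Lemma mx2D a b c d a' b' c' d' :
  mx2 a b c d + mx2 a' b' c' d' = mx2 (a + a') (b + b') (c + c') (d + d').
Proof. by apply/matrixP => i j; rewrite !mxE; do 2!case: ifP. Qed.

Lemma mx2Z x a b c d : x *: mx2 a b c d = mx2 (x * a) (x * b) (x * c) (x * d).
Proof. by apply/matrixP => i j; rewrite !mxE; do 2!case: ifP. Qed.

Lemma mx2_1 : 1%:M = mx2 1 0 0 1.
Proof.
apply/matrixP => i j; rewrite !mxE.
by case: (ord2P i) => ->; case: (ord2P j) => ->.
Qed.

Definition nilp_mx w := mx2 (1 + w) (-2) (w - 2) (- 1 - w).
Definition idem_mx w := mx2 (w - 1) (- 1 - w) (-3) (2 - w).
Definition dual_mx := mx2 1 (-1) 1 0.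

(* The trace of [nilp_mx w *m M]. *)
Definition ntr w M :=
  (1 + w) * M 0 0 - 2 * M 1 0 + (w - 2) * M 0 1 - (1 + w) * M 1 1.

(* Cramer's rule: if [w * w = -5], the determinant of the coordinates of [1%:M],
   [idem_mx w], [nilp_mx w], [dual_mx] is -1. *)
Definition idem_coord w M :=
  (w - 4) * (M 0 0 - M 1 1 + M 0 1) - 2 * w * (M 0 1 + M 1 0).
Definition nilp_coord w M :=
  (w + 4) * (M 0 0 - M 1 1 + M 0 1) + (w - 4) * (M 0 1 + M 1 0).
Definition one_coord w M :=
  M 1 1 - (2 - w) * idem_coord w M + (1 + w) * nilp_coord w M.

Lemma mx2_coord w M : w * w = -5 ->
  M = one_coord w M *: 1%:M + idem_coord w M *: idem_mx w
      + nilp_coord w M *: nilp_mx w + ntr w M *: dual_mx.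
Proof.
move=> hw; rewrite [LHS]mx2_eta mx2_1 !mx2Z !mx2D.
rewrite /one_coord /idem_coord /nilp_coord /ntr; congr mx2; ring: hw.
Qed.

Lemma span_mx2 w x y z : x *: 1%:M + y *: idem_mx w + z *: nilp_mx w =
  mx2 (x + y * (w - 1) + z * (1 + w)) (y * (- 1 - w) - z * 2)
      (z * (w - 2) - y * 3) (x + y * (2 - w) + z * (- 1 - w)).
Proof. by rewrite mx2_1 !mx2Z !mx2D; congr mx2; ring. Qed.

Lemma ntr_linear w a M M' : ntr w (a *: M + M') = a * ntr w M + ntr w M'.
Proof. by rewrite /ntr !mxE; ring. Qed.

Lemma idem_coord_linear w a M M' :
  idem_coord w (a *: M + M') = a * idem_coord w M + idem_coord w M'.
Proof. by rewrite /idem_coord !mxE; ring. Qed.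

Lemma nilp_coord_linear w a M M' :
  nilp_coord w (a *: M + M') = a * nilp_coord w M + nilp_coord w M'.
Proof. by rewrite /nilp_coord !mxE; ring. Qed.

Lemma one_coord_linear w a M M' :
  one_coord w (a *: M + M') = a * one_coord w M + one_coord w M'.
Proof.
by rewrite /one_coord idem_coord_linear nilp_coord_linear !mxE; ring.
Qed.

Lemma ntr_dual_mx w : ntr w dual_mx = 1.
Proof. by rewrite /ntr !mxE /=; ring. Qed.

Section SpanCoord.
Variables (w x y z : A).
Hypothesis hw : w * w = -5.

Lemma ntr_span : ntr w (x *: 1%:M + y *: idem_mx w + z *: nilp_mx w) = 0.
Proof. by rewrite span_mx2 /ntr !mxE /=; ring: hw. Qed.

Lemma idem_coord_span :
  idem_coord w (x *: 1%:M + y *: idem_mx w + z *: nilp_mx w) = y.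
Proof. by rewrite span_mx2 /idem_coord !mxE /=; ring: hw. Qed.

Lemma nilp_coord_span :
  nilp_coord w (x *: 1%:M + y *: idem_mx w + z *: nilp_mx w) = z.
Proof. by rewrite span_mx2 /nilp_coord !mxE /=; ring: hw. Qed.

Lemma one_coord_span :
  one_coord w (x *: 1%:M + y *: idem_mx w + z *: nilp_mx w) = x.
Proof.
rewrite /one_coord idem_coord_span nilp_coord_span span_mx2 !mxE /=.
ring: hw.
Qed.

End SpanCoord.

Lemma ntr0_span w M : w * w = -5 -> ntr w M = 0 ->
  M = one_coord w M *: 1%:M + idem_coord w M *: idem_mx w
      + nilp_coord w M *: nilp_mx w.
Proof. by move=> hw M0; rewrite {1}(mx2_coord M hw) M0 scale0r addr0. Qed.

(** In the coordinates on 1, A, N this is a polynomial identity modulo w^2 = -5. *)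
Lemma ntr_mul w M M' : w * w = -5 ->
  ntr w M = 0 -> ntr w M' = 0 -> ntr w (M *m M') = 0.
Proof.
move=> hw /(ntr0_span hw) -> /(ntr0_span hw) ->; rewrite !span_mx2 mx2M.
by rewrite /ntr !mxE /=; ring: hw.
Qed.

Lemma ntr1 w : ntr w 1%:M = 0.
Proof. by rewrite /ntr !mxE /=; ring. Qed.

Lemma ntr_idem w : w * w = -5 -> ntr w (idem_mx w) = 0.
Proof. by move=> hw; rewrite /ntr !mxE /=; ring: hw. Qed.

Lemma ntr_nilp w : w * w = -5 -> ntr w (nilp_mx w) = 0.
Proof. by move=> hw; rewrite /ntr !mxE /=; ring: hw. Qed.

Lemma mx2_inv1 a : mx2 1 0 (- a) 1 *m mx2 1 0 a 1 = 1%:M.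
Proof. by rewrite mx2M mx2_1; congr mx2; ring. Qed.

Lemma mx2_inv2 a : mx2 a 1 1 0 *m mx2 0 1 1 (- a) = 1%:M.
Proof. by rewrite mx2M mx2_1; congr mx2; ring. Qed.

Lemma mx2_inv3 a : mx2 0 1 1 (- a) *m mx2 a 1 1 0 = 1%:M.
Proof. by rewrite mx2M mx2_1; congr mx2; ring. Qed.

(** Where 2 has the inverse [u], the vector (1, (1 + w) u) spans ker N. In a basis starting with it,
    the lower left entry of [M] is the obstruction to stabilizing that line. *)
Lemma lower_left1 w u M : w * w = -5 -> 2 * u = 1 ->
  (mx2 1 0 (- ((1 + w) * u)) 1 *m M *m mx2 1 0 ((1 + w) * u) 1) 1 0 =
  - u * ntr w M.
Proof.
move=> hw hu; rewrite {1}[M]mx2_eta !mx2M !mxE /=.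
(* The error term is a multiple of [1 - 2 * u], so [ring] needs only the equation of [w]. *)
transitivity (- u * ntr w M + (1 - 2 * u) * (M 1 0 + u * (w - 2) * M 0 1)).
  by rewrite /ntr; ring: hw.
by rewrite hu subrr mul0r addr0.
Qed.

(** Where [w - 2] is invertible, ker N is spanned by ((1 + w) u, 1), because (1 + w)^2 = 2 (w -
    2). *)
Lemma lower_left2 w u M : w * w = -5 -> (w - 2) * u = 1 ->
  (mx2 0 1 1 (- ((1 + w) * u)) *m M *m mx2 ((1 + w) * u) 1 1 0) 1 0 =
  u * ntr w M.
Proof.
move=> hw hu; rewrite {1}[M]mx2_eta !mx2M !mxE /=.
transitivity (u * ntr w M + (1 - (w - 2) * u) * (M 0 1 + 2 * u * M 1 0)).
  by rewrite /ntr; ring: hw.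
by rewrite hu subrr mul0r addr0.
Qed.

End TwoByTwo.

Section Map.
Variables (A B : comPzRingType) (f : {rmorphism A -> B}).

Lemma map_mx2 a b c d : map_mx f (mx2 a b c d) = mx2 (f a) (f b) (f c) (f d).
Proof. by apply/matrixP => i j; rewrite !mxE; do 2!case: ifP. Qed.

Lemma map_nilp w : map_mx f (nilp_mx w) = nilp_mx (f w).
Proof.
by rewrite map_mx2 !(rmorphB, rmorphD, rmorphN, rmorph1, rmorph_nat).
Qed.

Lemma map_idem w : map_mx f (idem_mx w) = idem_mx (f w).
Proof.
by rewrite map_mx2 !(rmorphB, rmorphD, rmorphN, rmorph1, rmorph_nat).
Qed.

Lemma ntr_map w M : ntr (f w) (map_mx f M) = f (ntr w M).
Proof.
by rewrite /ntr !mxE !(rmorphB, rmorphD, rmorphM, rmorph1, rmorph_nat).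
Qed.

Lemma idem_coord_map w M : idem_coord (f w) (map_mx f M) = f (idem_coord w M).
Proof.
by rewrite /idem_coord !mxE !(rmorphB, rmorphD, rmorphM, rmorph1, rmorph_nat).
Qed.

Lemma nilp_coord_map w M : nilp_coord (f w) (map_mx f M) = f (nilp_coord w M).
Proof.
by rewrite /nilp_coord !mxE !(rmorphB, rmorphD, rmorphM, rmorph1, rmorph_nat).
Qed.

Lemma one_coord_map w M : one_coord (f w) (map_mx f M) = f (one_coord w M).
Proof.
rewrite /one_coord idem_coord_map nilp_coord_map !mxE.
by rewrite !(rmorphB, rmorphD, rmorphM, rmorph1, rmorph_nat).
Qed.

End Map.

(** Both [s] and 0 glue the zero family on the opens where [s] vanishes. *)
Lemma section_eq0 (X : ringed_space) (U : opens X) (s : OX U) :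
  (forall x, U x -> exists (V : opens X) (h : V `<=` U), V x /\ res h s = 0) ->
  s = 0.
Proof.
move=> s0; pose I := {V : opens X | exists h : V `<=` U, res h s = 0}.
have hV (v : I) : sval v `<=` U by case: v => V /= [h _]; apply: h.
have cov : U `<=` \bigcup_(v : I) sval v.
  by move=> x /s0[V [h [Vx sV]]]; exists (exist _ V (ex_intro _ h sV)).
have [|t [_ tu]] := @OX_sheaf X U I sval hV cov (fun v => 0).
  by move=> v v' W hv hv'; rewrite !rmorph0.
rewrite -(tu 0) => [|v]; last exact: rmorph0.
apply/esym/tu => v; have [h hr] := svalP v.
by rewrite (Prop_irrelevance (hV v) h).
Qed.

(** * The representation by A and N on a ringed space with w^2 = -5, and its Borel mold *)

Section BorelRepresentation.
Variables (X : ringed_space) (w : OX (top_open X)).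
Hypothesis hw : w * w = -5.

Let wU (U : opens X) : OX U := res (@sub_top X U) w.

Let hwU (U : opens X) : wU U * wU U = -5.
Proof. by rewrite -rmorphM hw rmorphN rmorph_nat. Qed.

Let res_wU (U V : opens X) (h : V `<=` U) : res h (wU U) = wU V.
Proof. exact: res_comp. Qed.

Definition gen2_mx (k : 'I_2) : 'M[OX (top_open X)]_2 :=
  if k == 0 then idem_mx w else nilp_mx w.

Definition rep_mx (g : free_monoid 2) : 'M[OX (top_open X)]_2 :=
  foldr (fun k M => gen2_mx k *m M) 1%:M g.

Fact rep_mxM (g h : free_monoid 2) : rep_mx (g * h)%g = rep_mx g *m rep_mx h.
Proof.
elim: g => [|k g IH]; first by rewrite mul1mx.
by rewrite -mulmxA -IH.
Qed.

Definition borel_rep : representation (free_monoid 2) 2 X :=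
  Representation (erefl : rep_mx 1%g = 1%:M) rep_mxM.

Lemma borel_rep_idem : borel_rep [:: 0] = idem_mx w.
Proof. exact: mulmx1. Qed.

Lemma borel_rep_nilp : borel_rep [:: 1] = nilp_mx w.
Proof. exact: mulmx1. Qed.

Let tsec (U : opens X) : set (msec (mxsheaf X 2 2) U) :=
  [set M | ntr (wU U) M = 0].

Fact ntr_sub0 (U : opens X) : @tsec U 0.
Proof. by rewrite /tsec /= /ntr !mxE; ring. Qed.

Fact ntr_sub_linear (U : opens X) a s t :
  @tsec U s -> @tsec U t -> @tsec U (a *: s + t).
Proof.
by rewrite /tsec /= => s0 t0; rewrite ntr_linear s0 t0 mulr0 addr0.
Qed.

Fact ntr_sub_res (U V : opens X) (h : V `<=` U) s :
  @tsec U s -> tsec (mres h s).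
Proof. by rewrite /tsec /= -(res_wU h) ntr_map => ->; rewrite rmorph0. Qed.

Fact ntr_sub_local (U : opens X) s :
  (forall x, U x -> exists (V : opens X) (h : V `<=` U),
     V x /\ tsec (mres h s)) -> @tsec U s.
Proof.
move=> hs; apply: section_eq0 => x /hs[V [h [Vx]]].
by rewrite /tsec /= -(res_wU h) ntr_map; exists V, h.
Qed.

Definition ntr_sub : submod (mxsheaf X 2 2) :=
  Submod ntr_sub0 ntr_sub_linear ntr_sub_res ntr_sub_local.

Lemma ntr_sub_subalgebra : is_subalgebra ntr_sub.
Proof.
move=> U; split=> [|P Q]; first exact: ntr1.
exact: ntr_mul.
Qed.

(** The kernel of [ntr] is one of the algebras containing the image, which bounds the intersection
    from above; each of those algebras contains 1, A and N, which span the kernel. *)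
Lemma generated_ntr (U : opens X) (M : 'M[OX U]_2) :
  generated_algebra borel_rep U M <-> ntr (wU U) M = 0.
Proof.
split=> [gM|M0]; last move=> /= A Aalg Ar.
  apply: (gM ntr_sub ntr_sub_subalgebra).
  elim=> [|k g IH]; first exact: (ntr_sub_subalgebra _).1.
  apply: (ntr_sub_subalgebra _).2 => //.
  rewrite /= /tsec /= /wU res_id /gen2_mx.
  by case: ifP => _; [apply: ntr_idem|apply: ntr_nilp].
rewrite (ntr0_span (hwU U) M0) -addrA.
have A1 : A U 1%:M by have [] := Aalg U.
have Aidem : A U (idem_mx (wU U)).
  have Atop : A (top_open X) (idem_mx w) by rewrite -borel_rep_idem; apply: Ar.
  by have := ssec_res (@sub_top X U) Atop; rewrite /= /resmx map_idem.
have Anilp : A U (nilp_mx (wU U)).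
  have Atop : A (top_open X) (nilp_mx w) by rewrite -borel_rep_nilp; apply: Ar.
  by have := ssec_res (@sub_top X U) Atop; rewrite /= /resmx map_nilp.
apply: ssec_linear => //; apply: ssec_linear => //.
rewrite -[_ *: _]addr0; apply: ssec_linear => //; exact: ssec0.
Qed.

Let gen := generated_algebra borel_rep.

Lemma gen_subalgebra : is_subalgebra gen.
Proof.
move=> U; split=> [|P Q /generated_ntr P0 /generated_ntr Q0].
  by apply/generated_ntr/ntr1.
exact/generated_ntr/ntr_mul.
Qed.

Definition span_coord (U : opens X) (s : msec (subsheaf gen) U) :
    msec (free_sheaf X 3) U :=
  let M : 'M[OX U]_2 := val s in
  \col_k [:: one_coord (wU U) M; idem_coord (wU U) M; nilp_coord (wU U) M]`_k.

Fact span_coord_linear (U : opens X) : linear (@span_coord U).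
Proof.
move=> a s t; apply/matrixP => k j; rewrite !mxE.
case: k => -[|[|[|k]]] //= _.
- exact: one_coord_linear.
- exact: idem_coord_linear.
- exact: nilp_coord_linear.
Qed.

HB.instance Definition _ (U : opens X) :=
  GRing.isLinear.Build (OX U) (msec (subsheaf gen) U)
    (msec (free_sheaf X 3) U) *:%R (@span_coord U) (@span_coord_linear U).

Fact span_of_subproof (U : opens X) (c : 'cV[OX U]_3) :
  @sub_pred X _ gen U
    (c 0 0 *: 1%:M + c 1 0 *: idem_mx (wU U) + c 2 0 *: nilp_mx (wU U)).
Proof. by apply/asboolP/generated_ntr/ntr_span. Qed.

Definition span_of (U : opens X) (c : msec (free_sheaf X 3) U) :
  msec (subsheaf gen) U := Sub _ (span_of_subproof c).

Lemma span_coord_bij (U : opens X) : bijective (@span_coord U).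
Proof.
exists (@span_of U) => [s|c].
  apply: val_inj; rewrite /= !mxE /= -ntr0_span //.
  exact/generated_ntr/asboolP/(valP s).
apply/matrixP => k j; rewrite !mxE /= (ord1 j).
case: k => -[|[|[|k]]] //= k3.
- by rewrite one_coord_span //; congr (c _ _); apply: val_inj.
- by rewrite idem_coord_span //; congr (c _ _); apply: val_inj.
- by rewrite nilp_coord_span //; congr (c _ _); apply: val_inj.
Qed.

Lemma gen_locally_free : locally_free (subsheaf gen).
Proof.
move=> x; exists (top_open X) => //; exists 3.
exists (fun V _ => [the {linear _ -> _} of @span_coord V]).
split=> [V _|V W _ _ h s]; first exact: span_coord_bij.
apply/matrixP => k j; rewrite !mxE /= -(res_wU h).
case: k => -[|[|[|k]]] //= _.
- exact: one_coord_map.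
- exact: idem_coord_map.
- exact: nilp_coord_map.
Qed.

Definition ntr_hom (U : opens X) (M : msec (mxsheaf X 2 2) U) :
  msec (free_sheaf X 1) U := \col_k ntr (wU U) M.

Fact ntr_hom_linear (U : opens X) : linear (@ntr_hom U).
Proof.
by move=> a s t; apply/matrixP => k j; rewrite !mxE; apply: ntr_linear.
Qed.

HB.instance Definition _ (U : opens X) :=
  GRing.isLinear.Build (OX U) (msec (mxsheaf X 2 2) U)
    (msec (free_sheaf X 1) U) *:%R (@ntr_hom U) (@ntr_hom_linear U).

Fact ntr_hom_nat (U V : opens X) (h : V `<=` U) s :
  ntr_hom (mres h s) = mres h (ntr_hom s).
Proof.
by apply/matrixP => k j; rewrite !mxE /= -(res_wU h); apply: ntr_map.
Qed.

Definition ntr_mod_hom : mod_hom (mxsheaf X 2 2) (free_sheaf X 1) :=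
  @ModHom X _ _ (fun U => [the {linear _ -> _} of @ntr_hom U]) ntr_hom_nat.

(** The quotient is O_X itself, with [ntr] as projection; it is onto because [ntr] takes the value 1
    on D. *)
Lemma gen_quotient : locally_free_quotient gen.
Proof.
exists (free_sheaf X 1), ntr_mod_hom; split; last first.
  move=> x; exists (top_open X) => //; exists 1%N.
  exists (fun V _ => [the {linear _ -> _} of idfun]).
  by split=> // V _; exists id.
split=> [U t x Ux|U s].
  exists U, (fun _ => id), ((t : 'cV_1) 0 0 *: dual_mx (OX U)).
  split=> //; apply/matrixP => k j; rewrite !mxE !ord1 res_id.
  rewrite -[_ *: _]addr0 ntr_linear ntr_dual_mx /ntr !mxE; ring.
rewrite generated_ntr; split=> [/matrixP/(_ 0 0)|s0]; first by rewrite !mxE.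
by apply/matrixP => k j; rewrite !mxE.
Qed.

Lemma gen_mold : mold gen.
Proof.
split; [exact: gen_subalgebra|exact: gen_locally_free|exact: gen_quotient].
Qed.

(** As [e] is a unit, the conjugate of [M] is upper triangular exactly when [ntr] vanishes on
    [M]. *)
Lemma conj_upper_triangular (U : opens X) (P Q : 'M[OX U]_2) (e : OX U) :
  Q *m P = 1%:M -> P *m Q = 1%:M -> (exists e', e * e' = 1) ->
  (forall (V : opens X) (h : V `<=` U) (M : 'M[OX V]_2),
     (resmx h Q *m M *m resmx h P) 1 0 = res h e * ntr (wU V) M) ->
  forall (V : opens X) (h : V `<=` U),
    [set resmx h Q *m M *m resmx h P | M in gen V] = upper_triangular X 2 V.
Proof.
move=> QP PQ [e' ee'] low V h.
have utE (M : 'M[OX V]_2) : upper_triangular X 2 V M <-> M 1 0 = 0.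
  split=> [/= M0|M0 /= j k]; first exact: M0.
  by case: (ord2P j) => ->; case: (ord2P k) => ->.
have resPQ : resmx h P *m resmx h Q = 1%:M by rewrite -map_mxM PQ map_mx1.
have resQP : resmx h Q *m resmx h P = 1%:M by rewrite -map_mxM QP map_mx1.
apply/seteqP; split=> [_ [M /generated_ntr M0 <-]|M /utE M0].
  by apply/utE; rewrite low M0 mulr0.
exists (resmx h P *m M *m resmx h Q); last first.
  by rewrite !mulmxA resQP mul1mx -mulmxA resQP mulmx1.
apply/generated_ntr.
rewrite -[ntr _ _]mul1r -(rmorph1 (res h)) -ee' rmorphM mulrAC -low.
by rewrite !mulmxA resQP mul1mx -mulmxA resQP mulmx1 M0 mul0r.
Qed.

(* One of [w - 2] and [2] is invertible near each point, since
   [(w - 2) * (- w - 2) + 2 * -4 = 1]; there [ker N] has a basis vector with an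
   entry 1. *)
Lemma gen_locally_equivalent :
  locally_ringed X -> locally_equivalent gen (upper_triangular X 2).
Proof.
move=> lX x.
have [|[U [h [Ux [t ht]]]]|[U [h [Ux [t ht]]]]] :=
  (lX x (top_open X) I).2 ((w - 2) * (- w - 2)) (2 * -4).
- exists (top_open X), (fun _ => id); split=> //; exists 1.
  by rewrite res_id mulr1; ring: hw.
- have hu : (wU U - 2) * ((- wU U - 2) * t) = 1.
    apply: etrans _ ht; rewrite mulrA !(rmorphM, rmorphB, rmorphN, rmorph_nat).
    by rewrite /wU (Prop_irrelevance h (@sub_top X U)).
  move: (_ * t) hu => u hu; exists U => //.
  exists (mx2 ((1 + wU U) * u) 1 1 0), (mx2 0 1 1 (- ((1 + wU U) * u))).
  split; [exact: mx2_inv2|exact: mx2_inv3|].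
  apply: (@conj_upper_triangular _ _ _ u).
  + exact: mx2_inv3.
  + exact: mx2_inv2.
  + by exists (wU U - 2); rewrite mulrC.
  + move=> V hV M; rewrite /resmx !map_mx2.
    rewrite !(rmorphM, rmorphN, rmorph1, rmorph0, rmorphD) res_wU.
    rewrite lower_left2 //; move/(congr1 (res hV)): hu.
    by rewrite rmorphM rmorphB res_wU rmorph_nat rmorph1.
- have hu : 2 * (-4 * t) = 1.
    by apply: etrans _ ht; rewrite mulrA !(rmorphM, rmorphN, rmorph_nat).
  move: (_ * t) hu => u hu; exists U => //.
  have i1 := mx2_inv1 ((1 + wU U) * u).
  have i2 := mx2_inv1 (- ((1 + wU U) * u)); rewrite opprK in i2.
  exists (mx2 1 0 ((1 + wU U) * u) 1), (mx2 1 0 (- ((1 + wU U) * u)) 1).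
  split=> //.
  apply: (@conj_upper_triangular _ _ _ (- u)) => //.
  + by exists (-2); rewrite mulrNN mulrC.
  + move=> V hV M; rewrite /resmx !map_mx2.
    rewrite !(rmorphM, rmorphN, rmorph1, rmorph0, rmorphD) res_wU.
    rewrite lower_left1 //; move/(congr1 (res hV)): hu.
    by rewrite rmorphM rmorph_nat rmorph1.
Qed.

Lemma borel_rep_with_borel_mold :
  locally_ringed X -> with_borel_mold borel_rep.
Proof.
by move=> lX; split; [exact: gen_mold|exact: gen_locally_equivalent].
Qed.

End BorelRepresentation.

(** * The ring Z[sqrt (-5)] *)

(* The pair [(a, b)] stands for [a + b * sqrt (-5)]. *)
Definition zsqrtm5 := (int * int)%type.

(** Only the additive group comes from the product, whose own multiplication is componentwise. *)
HB.instance Definition _ := GRing.Zmodule.on zsqrtm5.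

Definition zmul (x y : zsqrtm5) : zsqrtm5 :=
  (x.1 * y.1 - 5 * (x.2 * y.2), x.1 * y.2 + x.2 * y.1).

Fact zmulA : associative zmul.
Proof. by move=> [a b] [c d] [e f]; rewrite /zmul /=; congr pair; ring. Qed.
Fact zmulC : commutative zmul.
Proof. by move=> [a b] [c d]; rewrite /zmul /=; congr pair; ring. Qed.
Fact zmul1 : left_id ((1, 0) : zsqrtm5) zmul.
Proof. by move=> [a b]; rewrite /zmul /=; congr pair; ring. Qed.
Fact zmulDl : left_distributive zmul +%R.
Proof. by move=> [a b] [c d] [e f]; congr pair; rewrite /=; ring. Qed.

HB.instance Definition _ :=
  GRing.Zmodule_isComPzRing.Build zsqrtm5 zmulA zmulC zmul1 zmulDl.

Definition zroot : zsqrtm5 := (0, 1).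

Lemma zrootM : zroot * zroot = -5.
Proof. by []. Qed.

Definition zembed (x : zsqrtm5) : algC := x.1%:~R + x.2%:~R * sqrtC (-5).

Fact zembed_zmod : zmod_morphism zembed.
Proof. by move=> [a b] [c d]; rewrite /zembed /= !rmorphB; ring. Qed.

Fact zembed_monoid : monoid_morphism zembed.
Proof.
split=> [|[a b] [c d]]; first by rewrite /zembed /= mul0r addr0.
rewrite /zembed /= !(rmorphB, rmorphD, rmorphM) /=.
have := sqrtCK (-5 : algC); move: (sqrtC _) => s; rewrite expr2 => hs.
by ring: hs.
Qed.

HB.instance Definition _ :=
  GRing.isZmodMorphism.Build zsqrtm5 algC zembed zembed_zmod.
HB.instance Definition _ :=
  GRing.isMonoidMorphism.Build zsqrtm5 algC zembed zembed_monoid.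

(** Squaring a = - b sqrt(-5) gives a^2 + 5 b^2 = 0, which forces both integers to vanish. *)
Lemma zembed_inj : injective zembed.
Proof.
apply: raddf_inj => -[a b] /eqP; rewrite /zembed /= addr_eq0 => /eqP ab.
have /eqP : (a * a + 5 * (b * b))%:~R = 0 :> algC.
  rewrite !(rmorphD, rmorphM) /= ab mulrNN.
  have := sqrtCK (-5 : algC); move: (sqrtC _) => s; rewrite expr2 => hs.
  by ring: hs.
rewrite intr_eq0 => /eqP {}ab; congr pair; nia.
Qed.

(** The hypotheses make [a] a divisor of 2, so its norm is at most 4. This leaves only the pairs (2,
    1 + w) and (-2, -1 - w), whose entries generate a proper ideal. *)
Lemma no_unimodular_eigenvector (a b u v : zsqrtm5) :
  u * a + v * b = 1 -> (1 + zroot) * a = 2 * b -> False.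
Proof.
(* Multiplying [u * a + v * b = 1] by 2 and replacing 2 b by (1 + w) a exhibits this cofactor of
   [a]. *)
move=> uv ab; pose c := 2 * u + (1 + zroot) * v.
have ca : c * a = 2.
  transitivity (2 * (u * a) + (1 + zroot) * a * v); first by rewrite /c; ring.
  by rewrite ab -[RHS]mulr1 -uv; ring.
move: a b u v c ca uv ab => [a a'] [b b'] [u u'] [v v'] [c c'].
rewrite /GRing.mul /GRing.add /GRing.one /= /zmul /=.
move=> [e1 e2] [e5 e6] [e7 e8].
have norm : (c * c + 5 * (c' * c')) * (a * a + 5 * (a' * a')) = 4.
  transitivity ((c * a - 5 * (c' * a')) * (c * a - 5 * (c' * a')) +
    5 * ((c * a' + c' * a) * (c * a' + c' * a))); first by ring.
  by rewrite e1 e2.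
have sq (x : int) : 0 <= x * x by rewrite -expr2 sqr_ge0.
have nle : a * a + 5 * (a' * a') <= 4.
  move: norm (sq c) (sq c') (sq a) (sq a').
  move: (c * c) (c' * c') (a * a) (a' * a') => C C' A A' mn C0 C'0 A0 A'0.
  have : 0 <= C + 5 * C' by lia.
  have : 0 <= A + 5 * A' by lia.
  move: (C + _) (A + _) mn => m n mn n0 m0; clear - mn n0 m0.
  have [m00|] : m = 0 \/ 1 <= m by lia.
    by rewrite m00 mul0r in mn.
  nia.
(* A nonzero second component would contribute at least 5 to the norm. *)
have a'0 : a' = 0 by move: nle (sq a); clear; nia.
have a_even : a = 2 * b by rewrite a'0 in e7; lia.
have {e8} b'E : 2 * b' = a by rewrite a'0 in e8; lia.
have a_le : a * a <= 4 by rewrite a'0 in nle; lia.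
have b_le : b * b <= 1 by rewrite a_even in a_le; lia.
have b0 : b <> 0.
  by move=> b0; move: e1; rewrite a_even b0 a'0; clear; lia.
(* In both cases [e6] makes [v + v'] even, while [e5] makes [v - 5 * v'] odd. *)
have [b1|b1] : b = 1 \/ b = -1 by move: b_le b0; clear; nia.
  rewrite a'0 a_even b1 in e5 e6 b'E.
  by have b'1 : b' = 1 by [lia]; rewrite b'1 in e5 e6; lia.
rewrite a'0 a_even b1 in e5 e6 b'E.
by have b'1 : b' = -1 by [lia]; rewrite b'1 in e5 e6; lia.
Qed.

(** * A global generator of the line subbundle *)

(** This serves to lift all the basis vectors of a quotient over one neighbourhood. *)
Lemma common_open (T : topologicalType) (x : T) (n : nat)
    (P : 'I_n -> opens T -> Prop) :
  (forall k (V W : opens T), W `<=` V -> P k V -> P k W) ->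
  (forall k, exists2 V : opens T, V x & P k V) ->
  exists2 V : opens T, V x & forall k, P k V.
Proof.
move=> Psub Pk.
suff [V Vx VP] : exists2 V : opens T, V x & forall k, k \in enum 'I_n -> P k V.
  by exists V => // k; apply: VP; rewrite mem_enum.
elim: (enum _) => [|k s [V Vx VP]]; first by exists (top_open T).
have [W Wx WP] := Pk k.
exists (Opens (openI (open_carrier V) (open_carrier W))) => // l.
rewrite inE => /predU1P[->|ls]; first by apply: Psub WP => y [].
by apply: Psub (VP l ls) => y [].
Qed.

Lemma mod_hom_scale (X : ringed_space) (M N : sheaf_mod X) (f : mod_hom M N)
  (U : opens X) (a : OX U) (s : msec M U) : f U (a *: s) = a *: f U s.
Proof. exact: linearZ. Qed.

Section Generator.
Variables (X : ringed_space) (L : submod (free_sheaf X 2)).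
Variable phi : mod_hom (subsheaf L) (structure_sheaf X).
Hypothesis phi_bij : forall U, bijective (phi U).
Variable v : msec (subsheaf L) (top_open X).
Hypothesis phi_v : phi (top_open X) v = 1.

Let vU (U : opens X) : msec (subsheaf L) U := mres (@sub_top X U) v.

(** The coefficient is the image of [l] under [phi], since [phi] is injective and sends [v] to 1. *)
Lemma generatorP (U : opens X) (l : 'cV[OX U]_2) :
  L U l -> exists a : OX U, l = a *: resmx (@sub_top X U) (val v).
Proof.
move=> Ll; have Pl : @sub_pred X _ L U l by apply/asboolP.
pose s : msec (subsheaf L) U := Sub l Pl.
pose a : OX U := phi U s; exists a.
have -> : l = val s by [].
rewrite (_ : s = a *: vU U) //.
apply: (bij_inj (phi_bij U)); rewrite mod_hom_scale hom_nat phi_v.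
by rewrite /= rmorph1 /GRing.scale /= mulr1.
Qed.

Lemma generator_free (U : opens X) (a : OX U) :
  a *: resmx (@sub_top X U) (val v) = resmx (@sub_top X U) (val v) -> a = 1.
Proof.
move=> av; have e : a *: vU U = vU U by apply: val_inj.
have := congr1 (phi U) e; rewrite mod_hom_scale !hom_nat phi_v.
by rewrite /= rmorph1 /GRing.scale /= mulr1.
Qed.

(* Lifting a local basis of the quotient to sections [s k] of O^2 makes
   [v, s 0, ..., s (n - 1)] a local basis of O^2, so some linear form maps [v]
   to 1. *)
Lemma generator_unimodular : locally_ringed X -> locally_free_quotient L ->
  forall x : X,
    unit_at x ((val v : 'cV_2) 0 0) \/ unit_at x ((val v : 'cV_2) 1 0).
Proof.
move=> lX [Q [q [[qsurj qker] Qfree]]] x.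
have [U Ux [n [g [gbij gres]]]] := Qfree x.
have /choice[y yE] (k : 'I_n) : exists z, g U (fun _ => id) z = delta_mx k 0.
  have [f _ fK] := gbij U (fun _ => id).
  by exists (f (delta_mx k 0)).
pose P (k : 'I_n) (V : opens X) :=
  exists (h : V `<=` U) (s : msec (free_sheaf X 2) V), q V s = mres h (y k).
have Psub k (V W : opens X) : W `<=` V -> P k V -> P k W.
  move=> WV [h [s sE]]; exists (subset_trans WV h), (mres WV s).
  by rewrite hom_nat sE; apply: mres_comp.
have [|k|V0 V0x V0P] := @common_open _ x n P; first exact: Psub.
  have [V [h [s [Vx sE]]]] := qsurj U (y k) x Ux.
  by exists V => //; exists h, s.
pose V := Opens (openI (open_carrier V0) (open_carrier U)).
have h : V `<=` U by move=> z [].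
have /choice[s sE] k : exists s, q V s = mres h (y k).
  have [z []|h' [s sE]] := Psub k V0 V _ (V0P k) => //.
  by exists s; rewrite sE (Prop_irrelevance h' h).
pose gV := g V h.
have gs k : gV (q V (s k)) = delta_mx k 0.
  rewrite sE /gV (gres _ _ (fun _ => id)) yE /= /resmx.
  by apply/matrixP => i j; rewrite !mxE rmorph_nat.
have gsum (c : 'cV[OX V]_n) : gV (q V (\sum_k c k 0 *: s k)) = c.
  rewrite !linear_sum /= [RHS]matrix_sum_delta; apply: eq_bigr => k _.
  by rewrite big_ord1 !linearZ /= gs.
pose vV : 'cV[OX V]_2 := resmx (@sub_top X V) (val v).
have Lv : L V vV by exact/(ssec_res (@sub_top X V))/asboolP/(valP v).
(* Subtracting the lift of its class from [e] leaves a section of [L], hence a multiple of [v]. *)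
have decomp (e : 'cV[OX V]_2) : exists d t,
    gV (q V e) = d /\ e = \sum_k d k 0 *: s k + t *: vV.
  set d := gV (q V e).
  have /generatorP[t tE] : L V (e - \sum_k d k 0 *: s k).
    apply/qker; apply: (bij_inj (gbij V h)).
    by rewrite linear0 !linearB /= gsum subrr.
  by exists d, t; rewrite -tE addrC subrK.
have [a [b [aE bE vE]]] : exists a b, [/\ vV 0 0 = a, vV 1 0 = b &
    vV = a *: delta_mx 0 0 + b *: delta_mx 1 0].
  exists (vV 0 0), (vV 1 0); split=> //; apply/matrixP => i j.
  rewrite !mxE ord1.
  by case: (ord2P i) => -> /=; rewrite !(mulr1, mulr0, addr0, add0r).
have [d0 [t0 [d0E e0]]] := decomp (delta_mx 0 0).
have [d1 [t1 [d1E e1]]] := decomp (delta_mx 1 0).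
(* The class of [v] in the quotient is zero, so its coordinates on the [s k] vanish. *)
have dv : a *: d0 + b *: d1 = 0.
  have : gV (q V vV) = 0 by rewrite (qker V vV).2 // linear0.
  by rewrite vE !linearD !linearZ /= d0E d1E.
(* What remains of the decomposition is v = (a t0 + b t1) v, and [v] is a free generator. *)
have one : a * t0 + b * t1 = 1.
  apply: generator_free; rewrite -/vV [RHS]vE e0 e1 !scalerDr !scaler_sumr.
  rewrite addrACA -big_split /= big1 => [|k _].
    by rewrite add0r !scalerA -scalerDl.
  have /matrixP/(_ k 0) := dv; rewrite !mxE => dk.
  by rewrite !scalerA -scalerDl dk scale0r.
have : unit_at x (vV 0 0 * t0 + vV 1 0 * t1).
  rewrite aE bE.
  exists V, (fun _ => id); split=> //; exists 1.
  by rewrite one rmorph1 mulr1.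
have Vx : V x by [].
have unitl (i : 'I_2) (t : OX V) :
    unit_at x (vV i 0 * t) -> unit_at x ((val v : 'cV_2) i 0).
  move=> [W [WV [Wx [u tu]]]]; exists W, (@sub_top X W); split=> //.
  exists (res WV t * u); rewrite mulrA -tu rmorphM /vV mxE; congr (_ * _ * _).
  exact/esym/res_comp.
by move/((lX x V Vx).2 _ _) => [] /unitl; [left|right].
Qed.

End Generator.

(** * Nontriviality *)

Lemma nilp_mul0 (A : comPzRingType) (w : A) (x : 'cV[A]_2) :
  (nilp_mx w *m x) 0 0 = (1 + w) * x 0 0 - 2 * x 1 0.
Proof.
rewrite !mxE !big_ord_recl big_ord0 addr0 !mxE /= mulNr.
by congr (_ * x _ _ - _ * x _ _); apply: val_inj.
Qed.

Lemma nilp_mul1 (A : comPzRingType) (w : A) (x : 'cV[A]_2) :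
  (nilp_mx w *m x) 1 0 = (w - 2) * x 0 0 - (1 + w) * x 1 0.
Proof.
rewrite !mxE !big_ord_recl big_ord0 addr0 !mxE /= -opprD mulNr.
by congr (_ * x _ _ - _ * x _ _); apply: val_inj.
Qed.

Lemma unit_at_res (X : ringed_space) (x : X) (U V : opens X) (h : V `<=` U)
  (s : OX U) : V x -> unit_at x s -> unit_at x (res h s).
Proof.
move=> Vx [W [WU [Wx [t st]]]].
pose Z := Opens (openI (open_carrier V) (open_carrier W)).
have ZV : Z `<=` V by move=> z [].
have ZW : Z `<=` W by move=> z [].
have ZU := subset_trans ZV h.
exists Z, ZV; split=> //; exists (res ZW t).
rewrite (res_comp h ZV ZU) -(res_comp WU ZW ZU) -rmorphM st; exact: rmorph1.
Qed.

Lemma unit_at_comap (Y X : ringed_space) (f : morphism Y X) (y : Y)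
  (U : opens X) (s : OX U) : unit_at (f y) s -> unit_at y (comap f U s).
Proof.
move=> [V [h [Vx [t st]]]]; exists (Defs.preim (mor_cont f) V), (preim_sub h).
split=> //; exists (comap f V t).
by rewrite -comap_res -rmorphM st rmorph1.
Qed.

Definition zspec := spec_scheme zembed_inj.

Definition zspec_const : {rmorphism zsqrtm5 -> OX (top_open zspec)} :=
  [the {rmorphism _ -> _} of spec_const zembed (top_open (spec zsqrtm5))].

(** The whole space is D(1), and localizing at the powers of 1 changes nothing. *)
Lemma zspec_const_surj (s : OX (top_open zspec)) : exists a, s = zspec_const a.
Proof.
have [_ _ _ _ /(_ 1 (top_open zspec) (fun _ => id))] := spec_is_Spec zembed_inj.
case=> [x|_ /(_ s)[a [n]]].
  by have [_ _ _ x1 _] := svalP x; split.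
rewrite !rmorph1 expr1n mul1r => sa _; exists a; apply: etrans sa _.
exact: (@res_id zspec).
Qed.

Lemma zspec_const_inj : injective zspec_const.
Proof.
move=> a b ab; apply: zembed_inj.
pose eta : spec zsqrtm5 := exist _ _ (zero_prime zembed_inj).
by have := congr1 (fun s => val s (exist _ eta I)) ab.
Qed.

Theorem corollary4p6 (X : scheme) (r : representation (free_monoid 2) 2 X)
    (hX : is_RepB r) (L : submod (free_sheaf X 2))
    (hL : invariant_line_subbundle r L) :
  ~ isomorphic (subsheaf L) (structure_sheaf X).
Proof.
case: hL => -[_ Lquot] _ Linv [phi phi_bij].
have [v phi_v] : exists v, phi (top_open X) v = 1.
  by have [f _ fK] := phi_bij (top_open X); exists (f 1).
pose v0 : 'cV[OX (top_open X)]_2 := val v.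
have v_unit :=
  generator_unimodular phi_bij phi_v (@scheme_locally_ringed X) Lquot.
(* The second letter, to be specialized to N, maps the generator into its own line. *)
have [lam rv] : exists lam, r [:: 1] *m v0 = lam *: v0.
  have := Linv [:: 1] (top_open X) v0 (asboolW (valP v)).
  move=> /(generatorP phi_bij phi_v)[lam].
  rewrite [resmx _ (r _)]resmx_id [resmx _ (val v)]resmx_id => ->.
  by exists lam.
pose zw : OX (top_open zspec) := zspec_const zroot.
have hw : zw * zw = -5.
  by rewrite -[LHS]rmorphM zrootM rmorphN rmorph_nat.
have [f [fr _]] :=
  hX.2 zspec _ (borel_rep_with_borel_mold hw (@scheme_locally_ringed zspec)).
pose h := @sub_top zspec (top_open zspec) :
  top_open zspec `<=` Defs.preim (mor_cont f) (top_open X).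
(* This is the pullback of global functions along the classifying morphism. *)
pose psi := [the {rmorphism OX (top_open X) -> OX (top_open zspec)} of
  res h \o comap f (top_open X)].
have psi_unit y (i : 'I_2) : unit_at (f y) (v0 i 0) -> unit_at y (psi (v0 i 0)).
  by move=> u; apply: unit_at_res => //; apply: unit_at_comap.
have [a aE] := zspec_const_surj (psi (v0 0 0)).
have [b bE] := zspec_const_surj (psi (v0 1 0)).
have [l lE] := zspec_const_surj (psi lam).
have Nv : nilp_mx zw *m map_mx psi v0 = psi lam *: map_mx psi v0.
  rewrite -map_mxZ -rv map_mxM; congr (_ *m _).
  by rewrite -borel_rep_nilp fr /resmx -map_mx_comp.
have eq0 : (1 + zroot) * a - 2 * b = l * a.
  apply: zspec_const_inj.
  rewrite !(rmorphB, rmorphM, rmorphD, rmorph1, rmorph_nat) -aE -bE -lE.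
  have /matrixP/(_ 0 0) := Nv.
  by rewrite nilp_mul0 !mxE.
have eq1 : (zroot - 2) * a - (1 + zroot) * b = l * b.
  apply: zspec_const_inj.
  rewrite !(rmorphB, rmorphM, rmorphD, rmorph1, rmorph_nat) -aE -bE -lE.
  have /matrixP/(_ 1 0) := Nv.
  by rewrite nilp_mul1 !mxE.
(* At the point [y] of a prime [p], some entry of [v] is a unit at [f y]; its pullback is then a
   unit at [y], so [a] or [b] is outside [p]. *)
have [u [t uv]] : exists u t, u * a + t * b = 1.
  apply: coprime_unit => p pp pa pb; have [_ _ _ p1 _] := pp.
  pose y : zspec := exist _ p pp.
  have frac c :
      fraction_at zembed (val (spec_const zembed (top_open _) c)) y c 1.
    by split=> [//||z _]; rewrite rmorph1 ?oner_neq0 ?divr1.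
  have nonzero c : unit_at y (zspec_const c) -> ~ p c.
    exact: (@spec_unit_atP _ _ _ zembed_inj y (top_open _) I _ _ _ (frac c)).1.
  have [/psi_unit|/psi_unit] := v_unit (f y).
    by rewrite aE => /nonzero.
  by rewrite bE => /nonzero.
(* N^2 = 0 makes [l * l] kill both [a] and [b], hence 1, and the ring embeds in a field. *)
have l0 : l = 0.
  have ll : l * l = 0.
    have la : l * l * a = 0.
      rewrite -mulrA -eq0.
      transitivity ((1 + zroot) * (l * a) - 2 * (l * b)); first by ring.
      by rewrite -eq0 -eq1; ring: zrootM.
    have lb : l * l * b = 0.
      rewrite -mulrA -eq1.
      transitivity ((zroot - 2) * (l * a) - (1 + zroot) * (l * b)).
        by ring.
      by rewrite -eq0 -eq1; ring: zrootM.
    by rewrite -[l * l]mulr1 -uv mulrDr !(mulrCA (l * l)) la lb !mulr0 addr0.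
  apply: zembed_inj; apply/eqP; rewrite rmorph0 -[_ == 0]orbb -mulf_eq0.
  by rewrite -rmorphM ll rmorph0.
apply: (no_unimodular_eigenvector uv); apply/eqP.
by rewrite -subr_eq0 eq0 l0 mul0r.
Qed.
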